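(* Let $F:\mathbb{R}^d\to\mathbb{R}^d$ be smooth. A locally exact modification of the trapezoidal rule for $\dot x=F(x)$ is given by $$x_{n+1}-x_n=h_n\,\operatorname{tanhc}\!\left(\frac{h_nF'(\bar x)}{2}\right)\frac{F(x_{n+1})+F(x_n)}{2},$$ i.e., for sufficiently small $h_n$ (so that the matrix function is defined) this scheme is locally exact at $\bar x$, where $\bar x=\bar x_n$ is any sequence with $\bar x_n-x_n=O(h_n)$ (for instance $\bar x_n=x_n$ or $\bar x_n=\frac12(x_n+x_{n+1})$).
   Context: Notation: $F'$ is the Jacobi matrix of $F$; $h_n>0$ is the time step; $\operatorname{tanhc}(z)=z^{-1}\tanh z$, $\operatorname{tanhc}(0)=1$ (analytic at $0$); $\varphi_1(z)=(e^z-1)/z$, $\varphi_1(0)=1$. The trapezoidal rule is $x_{n+1}-x_n=\frac{h_n}{2}(F(x_n)+F(x_{n+1}))$; a modification of it is obtained by replacing $h_n$ by a matrix $\delta(\bar x_n,h_n)$ with $\lim_{h\to0}\delta(\bar x_n,h)/h=I$. Local exactness. Consider a one-step scheme (explicit or implicit) for $\dot x=F(x)$ whose coefficients may depend on a point $\bar x$ treated as a fixed parameter. The linearization of the scheme around $\bar x$ is obtained by substituting $x_n=\bar x+\nu_n$, $x_{n+1}=\bar x+\nu_{n+1}$ (with $\bar x$ held fixed) and keeping only terms of order at most one in $(\nu_n,\nu_{n+1})$. The linearization of the differential equation around $\bar x$ is $\dot\nu=F'(\bar x)\nu+F(\bar x)$, with $\nu=x-\bar x$; its exact discretization (the difference equation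 whose solution satisfies $\nu_n=\nu(t_n)$) is $\nu_{n+1}=e^{h_nF'(\bar x)}\nu_n+h_n\varphi_1(h_nF'(\bar x))F(\bar x)$. The scheme is locally exact at $\bar x$ if its linearization around $\bar x$, solved for $\nu_{n+1}$, is identical with this exact discretization. A scheme is locally exact if there is a sequence $\bar x_n$ with $\bar x_n-x_n=O(h_n)$ such that the scheme is locally exact at $\bar x_n$ for every $n$; the point $\bar x_n$ may be chosen depending on $x_n,x_{n+1}$, the choice being made after the linearization with $\bar x_n$ fixed. *)

(* Defs.v *)
From HB Require Import structures.
From mathcomp Require Import all_boot all_order all_algebra.
From mathcomp Require Import all_classical all_reals all_analysis.

Set Implicit Arguments.
Unset Strict Implicit.
Unset Printing Implicit Defensive.

Import Order.TTheory GRing.Theory Num.Theory.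
Import numFieldNormedType.Exports.

Local Open Scope classical_set_scope.
Local Open Scope ring_scope.

Section Smooth.
Context (R : realType) (V W : normedModType R).

(* For finite-dimensional V this is the usual class C^k: f is C^(k+1) iff it is
   differentiable and v-directional derivatives are C^k for each fixed v. *)
Fixpoint Ck (k : nat) (f : V -> W) : Prop :=
  if k is k'.+1 then
    (forall x, differentiable f x) /\ (forall v, Ck k' (fun x => 'd f x v))
  else continuous f.

Definition smooth (f : V -> W) : Prop := forall k, Ck k f.

End Smooth.

(* The library's 'J acts on row vectors from the right; for column vectors the
   entry (i, j) is the partial derivative of f_i with respect to x_j. *)
Definition jacobi (R : realType) (d : nat) (f : 'cV[R]_d -> 'cV[R]_d)
    (x : 'cV[R]_d) : 'M[R]_d :=
  \matrix_(i, j) ('D_(delta_mx j 0) f x) i 0.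

(* For f analytic at 0, f(A) is the sum of the Taylor series of f at 0 taken at
   the matrix A; it is defined when this series converges. *)
Section MatrixFunction.
Context (R : realType) (d : nat).

Definition mxtaylor (f : R -> R) (A : 'M[R]_d) : nat -> 'M[R]_d :=
  [series (derive1n k f 0 / k`!%:R) *: A ^+ k]_k.

Definition mxfun_defined (f : R -> R) (A : 'M[R]_d) : Prop :=
  cvgn (mxtaylor f A).

Definition mxfun (f : R -> R) (A : 'M[R]_d) : 'M[R]_d := limn (mxtaylor f A).

End MatrixFunction.

Section ScalarFunctions.
Context (R : realType).

Definition tanh (z : R) : R :=
  (expR z - expR (- z)) / (expR z + expR (- z)).

Definition tanhc (z : R) : R := if z == 0 then 1 else z^-1 * tanh z.

Definition phi1 (z : R) : R := if z == 0 then 1 else (expR z - 1) / z.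

End ScalarFunctions.

(* S xbar h is the residual of a one-step scheme with parameter xbar and time
   step h: the scheme is the equation S xbar h x_n x_(n+1) = 0. *)
Definition scheme (R : realType) (d : nat) : Type :=
  'cV[R]_d -> R -> 'cV[R]_d -> 'cV[R]_d -> 'cV[R]_d.

Section LocalExactness.
Context (R : realType) (d : nat) (F : 'cV[R]_d -> 'cV[R]_d) (S : scheme R d).

Definition solves (h : nat -> R) (x xbar : nat -> 'cV[R]_d) : Prop :=
  forall n, S (xbar n) (h n) (x n) (x n.+1) = 0.

Definition residual (xbar : 'cV[R]_d) (h : R) (p : 'cV[R]_d * 'cV[R]_d) :
    'cV[R]_d :=
  S xbar h p.1 p.2.

(* First-order expansion of S xbar h (xbar + nu) (xbar + nu') = 0 in (nu, nu'),
   the parameter xbar being held fixed. *)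
Definition linearized (h : R) (xbar nu nu' : 'cV[R]_d) : Prop :=
  residual xbar h (xbar, xbar)
  + 'd (residual xbar h) (xbar, xbar) (nu, nu') = 0.

Definition exact_step (h : R) (xbar nu : 'cV[R]_d) : 'cV[R]_d :=
  mxfun expR (h *: jacobi F xbar) *m nu
  + h *: (mxfun (@phi1 R) (h *: jacobi F xbar) *m F xbar).

(* The equivalence says that the linearization is uniquely solvable for nu' and
   that the solution is the exact discretization. *)
Definition locally_exact_at (h : R) (xbar : 'cV[R]_d) : Prop :=
  differentiable (residual xbar h) (xbar, xbar) /\
  forall nu nu', linearized h xbar nu nu' <-> nu' = exact_step h xbar nu.

(* The points xbar n are arbitrary, so they may depend on x n and x n.+1; the
   linearization in locally_exact_at is nevertheless taken with xbar n fixed. *)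
Definition locally_exact_with (h : nat -> R) (x xbar : nat -> 'cV[R]_d) :
    Prop :=
  (exists C : R, forall n, `|xbar n - x n| <= C * h n) /\
  (forall n, locally_exact_at (h n) (xbar n)).

End LocalExactness.

Section Trapezoidal.
Context (R : realType) (d : nat) (F : 'cV[R]_d -> 'cV[R]_d).

(* The trapezoidal rule itself is the case delta xbar h = h%:M. *)
Definition trapezoidal (delta : 'cV[R]_d -> R -> 'M[R]_d) : scheme R d :=
  fun xbar h x x' => x' - x - delta xbar h *m (2^-1 *: (F x' + F x)).

Definition admissible_step (delta : 'cV[R]_d -> R -> 'M[R]_d) : Prop :=
  forall xbar, h^-1 *: delta xbar h @[h --> (0 : R)^'] --> (1%:M : 'M[R]_d).

Definition tanhc_arg (h : R) (xbar : 'cV[R]_d) : 'M[R]_d :=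
  2^-1 *: (h *: jacobi F xbar).

Definition tanhc_step (xbar : 'cV[R]_d) (h : R) : 'M[R]_d :=
  h *: mxfun (@tanhc R) (tanhc_arg h xbar).

End Trapezoidal.

(* Main.v *)
Require Import Defs.
From HB Require Import structures.
From mathcomp Require Import all_boot all_order all_algebra.
From mathcomp Require Import all_classical all_reals all_analysis.
From mathcomp Require Import ring lra.

Set Implicit Arguments.
Unset Strict Implicit.
Unset Printing Implicit Defensive.

Import Order.TTheory GRing.Theory Num.Theory.
Import numFieldNormedType.Exports.

Local Open Scope classical_set_scope.
Local Open Scope ring_scope.

(** Write A = h F'(xbar) and B = A / 2, and let P = phi1(A), T = tanhc(B), with
the matrix functions understood as sums of Taylor series.  Linearizing the
scheme at xbar gives

      (1 - T B) nu' = (1 + T B) nu + h T F(xbar),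

and the exact discretization is nu' = exp(A) nu + h P F(xbar).  Put
E = 1 + P B.  Two identities between matrix functions settle the matter:

      exp(A) = 1 + P A        and        E T = P.

The second one gives E (1 - T B) = E - P B = 1, so that 1 - T B is always
invertible with inverse E; multiplying the linearized equation by E gives the
coefficients E (1 + T B) = 1 + 2 P B = exp(A) and h E T = h P
(solve_linearized).  Smallness of h serves to make the series defining T
converge.

The first identity is a shift of the exponential series (mxfun_expR).  The
second is the matrix form of tanhc(z) (1 + z phi1(2z)) = phi1(2z).  It holds for
the Taylor coefficients, and it passes to matrices by Mertens' theorem on Cauchy
products (mertens, mx_mertens): the series of E converges absolutely for every
matrix, and plain convergence of the series of T is enough.

The Taylor coefficients of tanhc at 0 come without computing derivatives.
Dividing the formal series of phi1(2z) by that of 1 + z phi1(2z) yields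
coefficients t with |t n| <= 2 ^ n (formal_quotient); by Mertens the sum of
t n z ^ n equals tanhc z near 0, hence these are the Taylor coefficients
(taylor_pseries, tanhc_coefP).  The bound also shows that T is defined as soon
as 2 d |B| < 1, which holds for small h because F' is continuous, hence bounded
near a point and, by compactness, on balls.  *)

(** * Cauchy products of series *)

Section CauchyProduct.
Context (R : realType).

(** For k below a fixed n0 the factor e (n - k) is small, and for k >= n0 it is
bounded while the tail of the series of |u k| is small. *)
Lemma convolution_cvg0 (u e : nat -> R) :
  cvgn [normed series u] -> e @ \oo --> 0 ->
  (fun n => \sum_(0 <= k < n) u k * e (n - k)%N) @ \oo --> 0.
Proof.
move=> cu ce; apply/cvgrPdist_le => eps eps0.
have [K [Kreal Ke]] := cvg_seq_bounded (cvgP _ ce).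
have {}Ke n : `|e n| <= `|K| + 1.
  by apply: Ke => //; rewrite (le_lt_trans (ler_norm K))// ltrDl.
set W := limn [normed series u] in cu.
have ndA : nondecreasing_seq [normed series u].
  by apply: nondecreasing_series => n _ _ /=.
have AW n : [normed series u] n <= W by exact: nondecreasing_cvgn_le.
have W0 : 0 <= W.
  by apply: le_trans (AW 0%N); rewrite /= /series /= big_geq.
have e10 : 0 < eps / 2 / (W + 1) by rewrite !divr_gt0// ltr_wpDl.
have e20 : 0 < eps / 2 / (`|K| + 1) by rewrite !divr_gt0// ltr_wpDl.
have /cvgrPdist_le/(_ _ e10)[m0 _ Hm0] := ce.
have /cvgrPdist_le/(_ _ e20)[n0 _ Hn0] := cu.
exists (n0 + m0)%N => // N /= leN.
have n0N : (n0 <= N)%N by exact: leq_trans (leq_addr _ _) leN.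
rewrite sub0r normrN (le_trans (ler_norm_sum _ _ _))//.
rewrite (@big_cat_nat _ _ _ n0)//= [leRHS]splitr; apply: lerD.
  apply: (@le_trans _ _ (\sum_(0 <= k < n0) `|u k| * (eps / 2 / (W + 1)))).
    rewrite big_nat_cond [leRHS]big_nat_cond; apply: ler_sum => k /andP[/andP[_ kn] _].
    rewrite normrM ler_wpM2l//.
    have /= := Hm0 (N - k)%N; rewrite sub0r normrN; apply.
    by rewrite /= leq_subRL ?(leq_trans (ltnW kn))// (leq_trans _ leN)// leq_add2r ltnW.
  rewrite -mulr_suml mulrCA ler_piMr ?divr_ge0 ?(ltW eps0)//.
  rewrite ler_pdivrMr ?ltr_wpDl// mul1r.
  by apply: (@le_trans _ _ W); [exact: AW | rewrite lerDl].
apply: (@le_trans _ _ (\sum_(n0 <= k < N) `|u k| * (`|K| + 1))).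
  by apply: ler_sum => k _; rewrite normrM ler_wpM2l.
rewrite -mulr_suml -ler_pdivlMr ?ltr_wpDl//.
have := Hn0 n0 (leqnn _); rewrite /= ger0_norm ?subr_ge0; last exact: AW.
apply: le_trans.
rewrite lerBrDl; apply: le_trans (AW N).
by rewrite /series /= [leRHS](@big_cat_nat _ _ _ n0).
Qed.

(** Only one of the two series has to converge absolutely: by summation over
diagonals, the partial sums of the Cauchy product are the convolutions of u with
the partial sums of v, and these differ from (series u n) * V by the convolution
of u with a null sequence. *)
Lemma mertens (u v : nat -> R) (U V : R) :
  cvgn [normed series u] -> series u @ \oo --> U -> series v @ \oo --> V ->
  series (fun n => \sum_(0 <= k < n.+1) u k * v (n - k)%N) @ \oo --> U * V.
Proof.
move=> nu cu cv.
have sumE : series (fun n => \sum_(0 <= k < n.+1) u k * v (n - k)%N) =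
    (fun n => series u n * V +
       \sum_(0 <= k < n) u k * (series v (n - k)%N - V)).
  apply/funext => n.
  transitivity (\sum_(0 <= k < n) u k * series v (n - k)%N).
    rewrite /series /=; elim: n => [|n IH] /=; first by rewrite !big_geq.
    rewrite big_nat_recr//= IH [RHS]big_nat_recr//= subSnn.
    rewrite [X in _ + X](big_nat_recr)//= subnn addrA -big_split/=; congr (_ + _).
      apply: eq_big_nat => k /andP[_ kn].
      by rewrite subSn ?(ltnW kn)// [in RHS]big_nat_recr//= mulrDr.
    by rewrite /series /= big_nat1.
  rewrite [series u n]/series /= mulr_suml -big_split/=.
  by apply: eq_bigr => k _; ring.
rewrite sumE -[U * V]addr0; apply: cvgD.
  by apply: cvgMl.
apply: (@convolution_cvg0 u (fun n => series v n - V)) => //.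
by rewrite -[X in _ --> X](subrr V); apply: cvgB => //; exact: cvg_cst.
Qed.

End CauchyProduct.

(** * Power series with geometrically bounded coefficients *)

Section GeometricBounds.
Context (R : realType).
Implicit Types (a c : nat -> R) (M q r x : R).

Lemma geometric_normed_cvg a M q : 0 <= q < 1 ->
  (forall n, `|a n| <= M * q ^+ n) -> cvgn [normed series a].
Proof.
move=> /andP[q0 q1] aM; apply: (series_le_cvg _ _ aM) => [n|n|].
- exact: normr_ge0.
- exact: le_trans (aM n).
- by apply: is_cvg_geometric_series; rewrite ger0_norm.
Qed.

Lemma geometric_lim_le a M q : 0 <= q < 1 ->
  (forall n, `|a n| <= M * q ^+ n) -> `|limn (series a)| <= M / (1 - q).
Proof.
move=> q01 aM; have cn := geometric_normed_cvg q01 aM.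
have /andP[q0 q1] := q01.
have qn1 : `|q| < 1 by rewrite ger0_norm.
apply: le_trans (lim_series_norm cn) _.
rewrite -(cvg_lim _ (@cvg_geometric_series _ M _ qn1))//.
by apply: lim_series_le => //; exact: is_cvg_geometric_series.
Qed.

Lemma pseries_term_le c M r x : (forall n, `|c n| <= M * r ^+ n) ->
  forall n, `|c n * x ^+ n| <= M * (r * `|x|) ^+ n.
Proof.
by move=> cM n; rewrite normrM normrX exprMn mulrA ler_wpM2r// exprn_ge0.
Qed.

Lemma pseries_cvg c M r x : 0 <= r -> (forall n, `|c n| <= M * r ^+ n) ->
  r * `|x| < 1 -> cvgn (pseries c x).
Proof.
move=> r0 cM rx; apply: normed_cvg.
apply: geometric_normed_cvg (pseries_term_le x cM).
by rewrite mulr_ge0.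
Qed.

(** From n + 1 <= 2 ^ n.  Doubling the ratio shrinks the interval of convergence,
which does no harm: derivatives are only needed at 0. *)
Lemma pseries_diffs_le c M r : 0 <= r -> (forall n, `|c n| <= M * r ^+ n) ->
  forall n, `|pseries_diffs c n| <= (M * r) * (2 * r) ^+ n.
Proof.
move=> r0 cM n; rewrite /pseries_diffs normrM normr_nat exprMn.
have M0 : 0 <= M by have := cM 0%N; rewrite mulr1; apply: le_trans.
have n2 : n.+1%:R <= 2 ^+ n :> R by rewrite -natrX ler_nat ltn_expl.
apply: (@le_trans _ _ (2 ^+ n * (M * r ^+ n.+1))).
  by apply: ler_pM => //; rewrite ?ler0n.
by rewrite exprS; lra.
Qed.

Lemma near0_mul_lt1 r : 0 <= r -> \forall x \near (0 : R), r * `|x| < 1.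
Proof.
move=> r0; near=> x.
apply: (@le_lt_trans _ _ ((r + 1) * `|x|)); first by rewrite ler_wpM2r// lerDl.
rewrite mulrC -ltr_pdivlMr ?ltr_wpDl// div1r.
near: x; apply: (@nbhs0_lt _ R^o); rewrite invr_gt0 ltr_wpDl//.
Unshelve. all: by end_near. Qed.

Lemma pseries_is_derive c M r : 0 <= r -> (forall n, `|c n| <= M * r ^+ n) ->
  \forall x \near (0 : R),
    is_derive x (1 : R) (fun y => limn (pseries c y))
      (limn (pseries (pseries_diffs c) x)).
Proof.
(* The second series of differences has ratio 4 r. *)
move=> r0 cM; pose K := (4 * r + 1)^-1.
have K0 : 0 < K by rewrite invr_gt0 ltr_wpDl// mulr_ge0.
have rK : 2 * (2 * r) * `|K| < 1.
  by rewrite gtr0_norm// ltr_pdivrMr ?ltr_wpDl ?mulr_ge0//; lra.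
near=> x; apply: (@pseries_snd_diffs R c K x).
- by apply: (pseries_cvg _ cM) => //; apply: le_lt_trans rK; rewrite ler_wpM2r//; lra.
- apply: (pseries_cvg _ (pseries_diffs_le r0 cM)); first by rewrite mulr_ge0.
  by apply: le_lt_trans rK; rewrite ler_wpM2r//; lra.
- apply: (pseries_cvg _ (pseries_diffs_le _ (pseries_diffs_le r0 cM))) => //;
    by rewrite ?mulr_ge0.
- by near: x; apply: (@nbhs0_lt _ R^o); rewrite gtr0_norm.
Unshelve. all: by end_near. Qed.

Lemma pseries_at0 c : limn (pseries c 0) = c 0%N.
Proof.
apply: cvg_lim => //; rewrite -cvg_shiftS.
apply: cvg_near_cst; near=> n.
rewrite /pseries /series /= big_nat_recl// expr0 mulr1 big1 ?addr0// => i _.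
by rewrite expr0n mulr0.
Unshelve. all: by end_near. Qed.

Lemma derive1n_near0_eq (n : nat) (f g : R -> R) :
  (\forall x \near (0 : R), f x = g x) -> derive1n n f 0 = derive1n n g 0.
Proof.
elim: n f g => [|n IH] f g fg; first exact: nbhs_singleton fg.
rewrite !derive1Sn; apply: IH.
have /filterS := near_join fg; apply => x fgx.
by rewrite !derive1E; apply: near_eq_derive.
Qed.

(** Near 0 the derivative of a power series is again a power series with
geometrically bounded coefficients, so induction on n reduces to the value at
0. *)
Lemma taylor_pseries (f : R -> R) c M r : 0 <= r ->
  (forall n, `|c n| <= M * r ^+ n) ->
  (\forall x \near (0 : R), f x = limn (pseries c x)) ->
  forall n, derive1n n f 0 / n`!%:R = c n.
Proof.
move=> r0 cM fc n; rewrite (derive1n_near0_eq _ fc) => {f fc}.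
suff -> : derive1n n (fun x => limn (pseries c x)) 0 = n`!%:R * c n.
  by rewrite mulrC mulKf// pnatr_eq0 -lt0n fact_gt0.
elim: n c M r r0 cM => [|n IH] c M r r0 cM.
  by rewrite mul1r derive1n0 pseries_at0.
rewrite derive1Sn.
rewrite (@derive1n_near0_eq _ _ (fun x => limn (pseries (pseries_diffs c) x))).
  rewrite (IH _ _ _ _ (pseries_diffs_le r0 cM)) ?mulr_ge0//.
  by rewrite /pseries_diffs factS natrM; ring.
have := pseries_is_derive r0 cM; apply: filterS => x dx.
by rewrite derive1E (@derive_val _ _ _ _ _ _ _ dx).
Qed.

End GeometricBounds.

(** * The power series of the scalar functions *)

Section ScalarFunctionSeries.
Context (R : realType).

Definition phi1_coef (k : nat) : R := (k.+1`!%:R)^-1.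

(** Coefficients of z |-> phi1 (2 * z). *)
Definition phi1_dbl_coef (k : nat) : R := 2 ^+ k / k.+1`!%:R.

(** Coefficients of 1 + z * p(z), where p has the coefficients p k.  For
p(z) = phi1 (2 * z) this function is (exp(2z) + 1) / 2, the denominator of
tanhc. *)
Definition shift1 (p : nat -> R) (k : nat) : R := if k is k'.+1 then p k' else 1.

(** The terms of the convergent exponential series at 1 / r are bounded.  As r is
arbitrary, such bounds make the corresponding matrix series converge for every
matrix. *)
Lemma inv_fact_le (r : R) : 0 < r ->
  exists M, forall k, `|(k`!%:R)^-1| <= M * r ^+ k :> R.
Proof.
move=> r0; have [K [Kreal HK]] := cvg_series_bounded (is_cvg_series_exp_coeff r^-1).
exists (`|K| + 1) => k.
have /HK/(_ k I) /= : K < `|K| + 1 by rewrite (le_lt_trans (ler_norm K))// ltrDl.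
rewrite /exp_coeff /= normrM ger0_norm ?exprn_ge0 ?invr_ge0 ?(ltW r0)//.
by rewrite exprVn mulrC ler_pdivrMr ?exprn_gt0.
Qed.

Lemma phi1_coef_le (r : R) : 0 < r ->
  exists M, forall k, `|phi1_coef k| <= M * r ^+ k.
Proof.
move=> /inv_fact_le[M HM]; exists M => k; apply: le_trans (HM k).
rewrite /phi1_coef !ger0_norm ?invr_ge0 ?ler0n//.
by rewrite lef_pV2 ?posrE ?ltr0n ?fact_gt0// ler_nat factS leq_pmull.
Qed.

Lemma phi1_dbl_coef_le (r : R) : 0 < r ->
  exists M, forall k, `|phi1_dbl_coef k| <= M * r ^+ k.
Proof.
move=> r0; have [M HM] := phi1_coef_le (divr_gt0 r0 (ltr0Sn R 1)); exists M => k.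
rewrite /phi1_dbl_coef normrM normrX normr_nat mulrC -ler_pdivlMr ?exprn_gt0//.
by have := HM k; rewrite exprMn exprVn mulrA.
Qed.

Lemma phi1_dbl_coef_le1 k : `|phi1_dbl_coef k| <= 1.
Proof.
rewrite /phi1_dbl_coef ger0_norm ?divr_ge0 ?exprn_ge0 ?ler0n//.
rewrite ler_pdivrMr ?ltr0n ?fact_gt0// mul1r -natrX ler_nat.
elim: k => // k IH; rewrite expnS factS; exact: leq_mul.
Qed.

(** The formal quotient p(z) / (1 + z p(z)): the convolution equation determines
t n from t 0, ..., t (n - 1), and since |p k| <= 1 it gives
|t n| <= 1 + |t 0| + ... + |t (n - 1)|, whence the bound 2 ^ n by induction. *)
Lemma formal_quotient (p : nat -> R) : (forall n, `|p n| <= 1) ->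
  exists2 t : nat -> R, (forall n, `|t n| <= 2 ^+ n) &
    forall n, \sum_(0 <= k < n.+1) shift1 p k * t (n - k)%N = p n.
Proof.
move=> p1.
(* s n is the list of the first n coefficients. *)
pose s := fix s n := if n is n'.+1 then
  rcons (s n') (p n' - \sum_(0 <= k < n') p k * (s n')`_(n' - k.+1)) else [::].
have ss n : size (s n) = n by elim: n => //= n IH; rewrite size_rcons IH.
pose t n := (s n.+1)`_n.
have st n m : (m < n)%N -> (s n)`_m = t m.
  elim: n => // n IH; rewrite ltnS leq_eqVlt => /orP[/eqP->//|mn].
  by rewrite /= nth_rcons ss mn IH.
have tE n : t n = p n - \sum_(0 <= k < n) p k * t (n - k.+1)%N.
  rewrite /t /= nth_rcons ss ltnn eqxx; congr (_ - _).
  apply: eq_big_nat => k /andP[_ kn]; rewrite st//.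
  by rewrite ltn_subrL (leq_ltn_trans _ kn).
exists t => n; last first.
  by rewrite big_nat_recl//= mul1r subn0 {1}tE subrK.
elim/ltn_ind: n => n IH; rewrite tE (le_trans (ler_normB _ _))//.
have two m : 1 + \sum_(0 <= k < m) 2 ^+ (m - k.+1) = 2 ^+ m :> R.
  elim: m => [|m IHm]; first by rewrite big_geq// addr0.
  rewrite big_nat_recl// subn1 /= addrCA.
  by under eq_bigr do rewrite subSS; rewrite IHm exprS; ring.
rewrite -two lerD// (le_trans (ler_norm_sum _ _ _))//.
rewrite big_nat_cond [leRHS]big_nat_cond; apply: ler_sum => k /andP[/andP[_ kn] _].
rewrite normrM -[leRHS]mul1r ler_pM//; apply: IH.
by rewrite ltn_subrL (leq_ltn_trans _ kn).
Qed.

Lemma expR_pseries (z : R) :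
  pseries (fun k => (k`!%:R)^-1) z @ \oo --> expR z.
Proof.
have -> : pseries (fun k => (k`!%:R)^-1) z = series (exp_coeff z).
  by rewrite /pseries exp_coeffE.
exact: is_cvg_series_exp_coeff.
Qed.

Lemma phi1_pseries_cvg (z : R) : cvgn (pseries phi1_coef z).
Proof.
have r0 : 0 < (`|z| + 1)^-1 by rewrite invr_gt0 ltr_wpDl.
have [M HM] := phi1_coef_le r0.
apply: (pseries_cvg (ltW r0) HM).
by rewrite mulrC ltr_pdivrMr ?ltr_wpDl// mul1r ltrDl.
Qed.

Lemma phi1_pseries (z : R) : phi1 z = limn (pseries phi1_coef z).
Proof.
rewrite /phi1; case: eqP => [->|/eqP z0].
  by rewrite pseries_at0 /phi1_coef invr1.
have cv := @phi1_pseries_cvg z.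
apply: (mulIf z0); rewrite divfK//.
apply/eqP; rewrite subr_eq; apply/eqP.
have e := @expR_pseries z.
rewrite -(cvg_lim _ e)//; apply: cvg_lim => //.
rewrite -cvg_shiftS.
have -> : (fun n => pseries (fun k => (k`!%:R)^-1) z n.+1) =
   (fun n => pseries phi1_coef z n * z + 1).
  apply/funext => n; rewrite /pseries /series /= big_nat_recl//.
  rewrite invr1 expr0 mul1r addrC mulr_suml; congr (_ + _).
  by apply: eq_bigr => k _; rewrite exprSr mulrA.
by apply: cvgD; [exact: cvgMl | exact: cvg_cst].
Qed.

Lemma phi1_dbl_pseries (z : R) : phi1 (2 * z) = limn (pseries phi1_dbl_coef z).
Proof.
rewrite phi1_pseries; congr (limn _); rewrite /pseries; congr series.
by apply/funext => k /=; rewrite exprMn /phi1_coef /phi1_dbl_coef; ring.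
Qed.

(** Multiply the numerator and the denominator of tanh by exp(z): then
tanh z = (exp(2z) - 1) / (exp(2z) + 1). *)
Lemma tanhc_phi1 (z : R) : tanhc z * (1 + phi1 (2 * z) * z) = phi1 (2 * z).
Proof.
rewrite /tanhc /phi1 mulf_eq0 pnatr_eq0/=; case: eqP => [->|/eqP z0].
  by rewrite mulr0 addr0 mulr1.
rewrite /tanh expRN expRM_natl.
have := expR_gt0 z; set e := expR z => e0.
have e1 : e ^+ 2 + 1 != 0 by rewrite gt_eqF// addr_gt0// exprn_gt0.
have e2 : e != 0 by rewrite gt_eqF.
by field; rewrite e2 e1 z0.
Qed.

Lemma phi1_dbl_neq0 (z : R) : 1 + phi1 (2 * z) * z != 0.
Proof.
rewrite /phi1 mulf_eq0 pnatr_eq0/=; have [->|z0] := eqVneq z 0.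
  by rewrite mulr0 addr0 oner_neq0.
have -> : 1 + (expR (2 * z) - 1) / (2 * z) * z = (expR (2 * z) + 1) / 2.
  by field.
by rewrite gt_eqF// divr_gt0// addr_gt0// expR_gt0.
Qed.

End ScalarFunctionSeries.

(** * Taylor coefficients of the scalar functions at 0 *)

Section TaylorCoefficients.
Context (R : realType).

Lemma shift1_le (p : nat -> R) (M r : R) : 0 < r ->
  (forall k, `|p k| <= M * r ^+ k) ->
  forall k, `|shift1 p k| <= (M / r + 1) * r ^+ k.
Proof.
move=> r0 pM.
have M0 : 0 <= M by have := pM 0%N; rewrite mulr1; apply: le_trans.
case=> [|k] /=; first by rewrite normr1 mulr1 lerDr divr_ge0// ltW.
rewrite (le_trans (pM k))// exprS mulrA mulrDl divfK ?gt_eqF// mul1r.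
by rewrite ler_wpM2r ?exprn_ge0 ?(ltW r0)// lerDl ltW.
Qed.

Lemma shift1_dbl_le (r : R) : 0 < r ->
  exists M, forall k, `|shift1 (@phi1_dbl_coef R) k| <= M * r ^+ k.
Proof.
move=> r0; have [M HM] := phi1_dbl_coef_le r0.
by exists (M / r + 1); apply: shift1_le.
Qed.

Lemma lt1_scale (x : R) : 0 <= x -> (x + 1)^-1 * x < 1.
Proof. by move=> x0; rewrite mulrC ltr_pdivrMr ?ltr_wpDl// mul1r ltrDl. Qed.

Lemma phi1_dbl_pseries_cvg (z : R) : cvgn (pseries (@phi1_dbl_coef R) z).
Proof.
have r0 : 0 < (`|z| + 1)^-1 by rewrite invr_gt0 ltr_wpDl.
have [M HM] := phi1_dbl_coef_le r0.
by apply: (pseries_cvg (ltW r0) HM); rewrite lt1_scale.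
Qed.

Lemma shift1_dbl_pseries (z : R) :
  pseries (shift1 (@phi1_dbl_coef R)) z @ \oo --> 1 + phi1 (2 * z) * z.
Proof.
rewrite -cvg_shiftS.
have -> : (fun n => pseries (shift1 (@phi1_dbl_coef R)) z n.+1) =
   (fun n => 1 + pseries (@phi1_dbl_coef R) z n * z).
  apply/funext => n; rewrite /pseries /series /= big_nat_recl// mulr1 mulr_suml.
  by congr (_ + _); apply: eq_bigr => k _; rewrite /= exprSr mulrA.
apply: cvgD; first exact: cvg_cst.
by apply: cvgMl; rewrite phi1_dbl_pseries; exact: phi1_dbl_pseries_cvg.
Qed.

(** The sum of the formal quotient solves the same equation as tanhc z, with the
nonzero factor 1 + phi1 (2 * z) * z, by Mertens' theorem.  The constant 1 in the
bound gives it the shape M * r ^+ n of the general lemmas. *)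
Lemma tanhc_pseries : exists2 t : nat -> R,
  (forall n, `|t n| <= 1 * 2 ^+ n) /\
  (forall n, \sum_(0 <= k < n.+1) shift1 (@phi1_dbl_coef R) k * t (n - k)%N =
             phi1_dbl_coef R n) &
  \forall x \near (0 : R), tanhc x = limn (pseries t x).
Proof.
have [t t2 tE] := formal_quotient (@phi1_dbl_coef_le1 R).
have {}t2 n : `|t n| <= 1 * 2 ^+ n by rewrite mul1r.
exists t => //; have := @near0_mul_lt1 R 2 (ler0n _ _); apply: filterS => x x1.
have cT : cvgn (pseries t x) by apply: (pseries_cvg _ t2) => //; rewrite ler0n.
apply: (mulIf (phi1_dbl_neq0 x)); rewrite tanhc_phi1 [RHS]mulrC.
rewrite [LHS]phi1_dbl_pseries; apply: cvg_lim => //.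
have r0 : 0 < (`|x| + 1)^-1 by rewrite invr_gt0 ltr_wpDl.
have [M HM] := shift1_dbl_le r0.
have nE : cvgn [normed series (fun k => shift1 (@phi1_dbl_coef R) k * x ^+ k)].
  apply: geometric_normed_cvg (pseries_term_le x HM).
  by rewrite mulr_ge0 ?(ltW r0)//= lt1_scale.
have := mertens nE (@shift1_dbl_pseries x) cT.
rewrite (_ : (fun n => _) = (fun n => phi1_dbl_coef R n * x ^+ n)) //.
apply/funext => n; rewrite -tE mulr_suml.
apply: eq_big_nat => k /andP[_ kn].
have -> : x ^+ n = x ^+ k * x ^+ (n - k)%N by rewrite -exprD subnKC.
by rewrite /=; ring.
Qed.

Lemma taylor_expR k : derive1n k (@expR R) 0 / k`!%:R = (k`!%:R)^-1.
Proof.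
have [M HM] := inv_fact_le (@ltr01 R).
apply: (taylor_pseries ler01 HM); near=> x.
by apply/esym/cvg_lim => //; exact: expR_pseries.
Unshelve. all: by end_near. Qed.

Lemma taylor_phi1 k : derive1n k (@phi1 R) 0 / k`!%:R = phi1_coef R k.
Proof.
have [M HM] := phi1_coef_le (@ltr01 R).
by apply: (taylor_pseries ler01 HM); near=> x; exact: phi1_pseries.
Unshelve. all: by end_near. Qed.

Definition tanhc_coef (k : nat) : R := derive1n k (@tanhc R) 0 / k`!%:R.

Lemma tanhc_coefP :
  (forall n, `|tanhc_coef n| <= 1 * 2 ^+ n) /\
  (forall n, \sum_(0 <= k < n.+1)
     shift1 (@phi1_dbl_coef R) k * tanhc_coef (n - k)%N = phi1_dbl_coef R n).
Proof.
have [t [t2 tE] tn] := tanhc_pseries.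
have tc k : tanhc_coef k = t k by exact: (taylor_pseries _ t2).
split=> n; first by rewrite tc.
by rewrite -tE; apply: eq_bigr => k _; rewrite tc.
Qed.

End TaylorCoefficients.

(** * Convergence and norms of matrices *)

Section Matrices.
Context (R : realType).

Lemma cvg_sum (T : Type) (F : set_system T) {FF : Filter F} n
    (f : 'I_n -> T -> R) (L : 'I_n -> R) :
  (forall k, f k @ F --> L k) ->
  \sum_(k < n) f k x @[x --> F] --> \sum_(k < n) L k.
Proof.
elim: n f L => [|n IH] f L fL.
  by rewrite big_ord0; under eq_fun do rewrite big_ord0; exact: cvg_cst.
rewrite big_ord_recl; under eq_fun do rewrite big_ord_recl.
by apply: cvgD => //; apply: IH.
Qed.

Lemma mx_cvg (T : Type) (F : set_system T) {FF : Filter F} m n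
    (f : T -> 'M[R]_(m, n)) (L : 'M[R]_(m, n)) :
  (forall i j, f x i j @[x --> F] --> L i j) -> f @ F --> L.
Proof.
move=> fL; apply/cvgrPdist_le => e e0.
have H : \forall x \near F, forall ij : 'I_m * 'I_n,
    `|L ij.1 ij.2 - f x ij.1 ij.2| <= e.
  apply: filter_forall => -[i j] /=.
  by have /cvgrPdist_le/(_ _ e0) := fL i j.
apply: filterS H => x Hx.
rewrite [leLHS]/Num.Def.normr /= mx_normrE; apply/bigmax_leP; split; first exact: ltW.
by move=> ij _; rewrite !mxE.
Qed.

Lemma entry_cvg (T : Type) (F : set_system T) {FF : Filter F} m n
    (f : T -> 'M[R]_(m, n)) (L : 'M[R]_(m, n)) i j :
  f @ F --> L -> f x i j @[x --> F] --> L i j.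
Proof.
move=> fL; apply: (cvg_comp f (fun M : 'M[R]_(m, n) => M i j) fL).
exact: coord_continuous.
Qed.

Lemma mx_entry_le m n (A : 'M[R]_(m, n)) i j : `|A i j| <= `|A|.
Proof.
rewrite [leRHS]/Num.Def.normr /= mx_normrE.
by apply/bigmax_geP; right => /=; exists (i, j).
Qed.

Lemma mx_norm_le m n (A : 'M[R]_(m, n)) (e : R) : 0 <= e ->
  (forall i j, `|A i j| <= e) -> `|A| <= e.
Proof.
move=> e0 Ae; rewrite [leLHS]/Num.Def.normr /= mx_normrE.
by apply/bigmax_leP; split => // ij _.
Qed.

Lemma mulmx_norm_le m n p (A : 'M[R]_(m, n)) (B : 'M[R]_(n, p)) :
  `|A *m B| <= n%:R * `|A| * `|B|.
Proof.
apply: mx_norm_le => [|i j]; first by rewrite !mulr_ge0.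
rewrite mxE (le_trans (ler_norm_sum _ _ _))//.
apply: (@le_trans _ _ (\sum_(k < n) `|A| * `|B|)).
  by apply: ler_sum => k _; rewrite normrM ler_pM// mx_entry_le.
by rewrite sumr_const card_ord -[leLHS]mulr_natl mulrA.
Qed.

Lemma mulmxr_cvg (T : Type) (F : set_system T) {FF : Filter F} m n p
    (f : T -> 'M[R]_(m, n)) (L : 'M[R]_(m, n)) (B : 'M[R]_(n, p)) :
  f @ F --> L -> f x *m B @[x --> F] --> L *m B.
Proof.
move=> fL; apply: mx_cvg => i j.
rewrite mxE; under eq_fun do rewrite mxE.
apply: cvg_sum => k.
by apply: cvgMl; exact: entry_cvg.
Qed.

Lemma mulmx_continuous m n p (A : 'M[R]_(m, n)) :
  continuous (mulmx A : 'M[R]_(n, p) -> 'M[R]_(m, p)).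
Proof.
move=> B; apply: (@mx_cvg _ (nbhs B)) => i j.
rewrite mxE; under eq_fun do rewrite mxE.
apply: cvg_sum => k.
by apply: cvgMr; exact: coord_continuous.
Qed.

Lemma series_entry m n (u : nat -> 'M[R]_(m, n)) N i j :
  series u N i j = series (fun k => u k i j) N.
Proof. by rewrite /series /= summxE. Qed.

Lemma series_entry_cvg m n (u : nat -> 'M[R]_(m, n)) (U : 'M[R]_(m, n)) i j :
  series u @ \oo --> U -> series (fun k => u k i j) @ \oo --> U i j.
Proof.
move=> /(entry_cvg (i := i) (j := j)).
by have -> : (fun N => series u N i j) = series (fun k => u k i j)
  by apply/funext => N; rewrite series_entry.
Qed.

(** Each entry of the Cauchy product is a finite sum of scalar Cauchy products.
Absolute convergence is asked entrywise and of u alone. *)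
Lemma mx_mertens m n p (u : nat -> 'M[R]_(m, n)) (v : nat -> 'M[R]_(n, p))
    (U : 'M[R]_(m, n)) (V : 'M[R]_(n, p)) :
  (forall i j, cvgn [normed series (fun k => u k i j)]) ->
  series u @ \oo --> U -> series v @ \oo --> V ->
  series (fun N => \sum_(0 <= k < N.+1) u k *m v (N - k)%N) @ \oo --> U *m V.
Proof.
move=> nu cu cv; apply: mx_cvg => i j; rewrite mxE.
under eq_fun do rewrite series_entry.
have -> : series (fun N => (\sum_(0 <= k < N.+1) u k *m v (N - k)%N) i j) =
   (fun M => \sum_(l < n) series (fun N =>
       \sum_(0 <= k < N.+1) u k i l * v (N - k)%N l j) M).
  apply/funext => M; rewrite /series /= exchange_big; apply: eq_bigr => N _.
  rewrite summxE exchange_big; apply: eq_bigr => k _.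
  by rewrite mxE.
apply: cvg_sum => l.
apply: (mertens (u := fun k => u k i l) (v := fun k => v k l j)) => //.
- exact: series_entry_cvg.
- exact: series_entry_cvg.
Qed.

Section Powers.
Context (d : nat).
Implicit Types A B : 'M[R]_d.

Lemma expmx_entry_le A k i j : `|(A ^+ k) i j| <= (d%:R * `|A|) ^+ k.
Proof.
elim: k i j => [|k IH] i j.
  by rewrite !expr0 mxE; case: eqP => _; rewrite ?normr1 ?normr0 ?ler01.
rewrite exprS mxE (le_trans (ler_norm_sum _ _ _))//.
apply: (@le_trans _ _ (\sum_(l < d) `|A| * (d%:R * `|A|) ^+ k)).
  by apply: ler_sum => l _; rewrite normrM ler_pM// mx_entry_le.
by rewrite sumr_const card_ord -[leLHS]mulr_natl mulrA exprS.
Qed.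

Lemma mx_term_le (c : nat -> R) (M r : R) A :
  (forall k, `|c k| <= M * r ^+ k) ->
  forall i j k, `|(c k *: A ^+ k) i j| <= M * (r * (d%:R * `|A|)) ^+ k.
Proof.
move=> cM i j k; rewrite mxE normrM exprMn mulrA.
by rewrite ler_pM// expmx_entry_le.
Qed.

Lemma mx_series_cvg (c : nat -> R) (M r : R) A : 0 <= r ->
  (forall k, `|c k| <= M * r ^+ k) -> r * (d%:R * `|A|) < 1 ->
  cvgn (series (fun k => c k *: A ^+ k)).
Proof.
move=> r0 cM rA; apply/cvg_ex.
exists (\matrix_(i, j) limn (series (fun k => (c k *: A ^+ k) i j))).
apply: mx_cvg => i j; rewrite mxE; under eq_fun do rewrite series_entry.
apply: normed_cvg; apply: geometric_normed_cvg (mx_term_le A cM i j).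
by rewrite rA !mulr_ge0.
Qed.

Lemma mx_series_lim_le (c : nat -> R) (M r : R) A i j : 0 <= r ->
  (forall k, `|c k| <= M * r ^+ k) -> r * (d%:R * `|A|) < 1 ->
  `|limn (series (fun k => c k *: A ^+ k)) i j| <= M / (1 - r * (d%:R * `|A|)).
Proof.
move=> r0 cM rA; have /(series_entry_cvg (i := i) (j := j)) := mx_series_cvg r0 cM rA.
move=> /cvg_lim <- //; apply: geometric_lim_le (mx_term_le A cM i j).
by rewrite rA !mulr_ge0.
Qed.

End Powers.
End Matrices.

(** * Identities between matrix functions *)

Section MatrixFunctions.
Context (R : realType) (d : nat).
Implicit Types A B : 'M[R]_d.

Lemma expmxZ (a : R) A k : (a *: A) ^+ k = a ^+ k *: A ^+ k.
Proof.
elim: k => [|k IH]; first by rewrite !expr0 scale1r.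
by rewrite !exprS IH -!mulmxE -scalemxAl -scalemxAr scalerA.
Qed.

Lemma mxtaylor_expR A :
  mxtaylor (@expR R) A = series (fun k => (k`!%:R)^-1 *: A ^+ k).
Proof. by congr series; apply/funext => k; congr (_ *: _); exact: taylor_expR. Qed.

Lemma mxtaylor_phi1 A :
  mxtaylor (@phi1 R) A = series (fun k => phi1_coef R k *: A ^+ k).
Proof. by congr series; apply/funext => k; congr (_ *: _); exact: taylor_phi1. Qed.

Lemma mxtaylor_phi1_dbl B :
  mxtaylor (@phi1 R) (2 *: B) = series (fun k => phi1_dbl_coef R k *: B ^+ k).
Proof.
rewrite mxtaylor_phi1; congr series; apply/funext => k.
by rewrite /= expmxZ scalerA /phi1_coef /phi1_dbl_coef mulrC.
Qed.

Lemma phi1_defined A : mxfun_defined (@phi1 R) A.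
Proof.
rewrite /mxfun_defined mxtaylor_phi1.
have r0 : 0 < (d%:R * `|A| + 1)^-1 by rewrite invr_gt0 ltr_wpDl// mulr_ge0.
have [M HM] := phi1_coef_le r0.
by apply: (mx_series_cvg (ltW r0) HM); rewrite lt1_scale// mulr_ge0.
Qed.

(** Matrix form of exp(z) = 1 + phi1(z) z: shift the exponential series by one
term. *)
Lemma mxfun_expR A :
  mxfun (@expR R) A = 1%:M + mxfun (@phi1 R) A *m A.
Proof.
apply: cvg_lim => //; rewrite mxtaylor_expR -cvg_shiftS.
have -> : (fun n => series (fun k => (k`!%:R)^-1 *: A ^+ k) n.+1) =
   (fun n => 1%:M + mxtaylor (@phi1 R) A n *m A).
  apply/funext => n; rewrite mxtaylor_phi1 /series /= big_nat_recl//.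
  rewrite invr1 scale1r expr0 mulmx_suml; congr (_ + _).
  by apply: eq_bigr => k _; rewrite exprSr -scalemxAl.
apply: cvgD; first exact: cvg_cst.
by apply: mulmxr_cvg; exact: phi1_defined.
Qed.

Lemma tanhc_defined B : 2 * (d%:R * `|B|) < 1 -> mxfun_defined (@tanhc R) B.
Proof.
by move=> B1; apply: (mx_series_cvg _ (tanhc_coefP R).1) => //; rewrite ler0n.
Qed.

Lemma mxfun_tanhc_le B i j : 2 * (d%:R * `|B|) < 1 ->
  `|mxfun (@tanhc R) B i j| <= (1 - 2 * (d%:R * `|B|))^-1.
Proof.
move=> B1; rewrite -[leRHS]mul1r.
by apply: (mx_series_lim_le i j _ (tanhc_coefP R).1 B1); rewrite ler0n.
Qed.

(** Matrix form of (1 + phi1(2z) z) tanhc(z) = phi1(2z), valid wherever the series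
of tanhc converges, even conditionally: the series of the first factor converges
absolutely, so Mertens' theorem applies. *)
Lemma mxfun_tanhc_phi1 B : mxfun_defined (@tanhc R) B ->
  (1%:M + mxfun (@phi1 R) (2 *: B) *m B) *m mxfun (@tanhc R) B =
  mxfun (@phi1 R) (2 *: B).
Proof.
move=> cT; apply/esym/cvg_lim => //; rewrite mxtaylor_phi1_dbl.
have r0 : 0 < (d%:R * `|B| + 1)^-1 by rewrite invr_gt0 ltr_wpDl// mulr_ge0.
have [M HM] := shift1_dbl_le r0.
have nE i j : cvgn [normed series (fun k =>
    (shift1 (phi1_dbl_coef R) k *: B ^+ k) i j)].
  apply: geometric_normed_cvg (mx_term_le B HM i j).
  by rewrite mulr_ge0 ?(ltW r0) ?mulr_ge0//= lt1_scale// mulr_ge0.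
have cE : series (fun k => shift1 (phi1_dbl_coef R) k *: B ^+ k) @ \oo -->
    1%:M + mxfun (@phi1 R) (2 *: B) *m B.
  rewrite -cvg_shiftS.
  have -> : (fun n => series (fun k => shift1 (phi1_dbl_coef R) k *: B ^+ k) n.+1)
      = (fun n => 1%:M + mxtaylor (@phi1 R) (2 *: B) n *m B).
    apply/funext => n; rewrite mxtaylor_phi1_dbl /series /= big_nat_recl//.
    rewrite scale1r expr0 mulmx_suml; congr (_ + _).
    by apply: eq_bigr => k _; rewrite exprSr -scalemxAl.
  apply: cvgD; first exact: cvg_cst.
  by apply: mulmxr_cvg; exact: phi1_defined.
have := mx_mertens nE cE cT.
rewrite (_ : (fun N => _) = (fun k => phi1_dbl_coef R k *: B ^+ k))//.
apply/funext => n; rewrite -(tanhc_coefP R).2 scaler_suml.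
apply: eq_big_nat => k /andP[_ kn].
by rewrite -scalemxAl -scalemxAr scalerA mulmxE -exprD subnKC.
Qed.

(** Each entry of tanhc (h B) is a scalar power series in h near 0, hence
continuous at 0, where its value is an entry of the identity matrix. *)
Lemma mxfun_tanhc_cvg1 B :
  mxfun (@tanhc R) (h *: B) @[h --> (0 : R)^'] --> (1%:M : 'M[R]_d).
Proof.
have [t2 tE] := tanhc_coefP R.
have t0 : tanhc_coef R 0 = 1.
  have := tE 0%N; rewrite big_nat1 /= mul1r subnn => ->.
  by rewrite /phi1_dbl_coef divr1.
apply: cvg_trans (_ : mxfun (@tanhc R) (h *: B) @[h --> (0 : R)] --> _).
  by apply: cvg_app; exact: cvg_within.
apply: mx_cvg => i j.
pose c k := tanhc_coef R k * (B ^+ k) i j.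
have dB0 : 0 <= 2 * (d%:R * `|B|) by rewrite !mulr_ge0.
have cM k : `|c k| <= 1 * (2 * (d%:R * `|B|)) ^+ k.
  by have := mx_term_le B t2 i j k; rewrite mxE.
have c0 : limn (pseries c 0) = (1%:M : 'M[R]_d) i j.
  by rewrite pseries_at0 /c t0 mul1r.
rewrite -c0.
apply: cvg_trans (_ : limn (pseries c h) @[h --> (0 : R)] --> _).
  apply: near_eq_cvg; have := near0_mul_lt1 dB0; apply: filterS => s s1.
  have hs : 2 * (d%:R * `|s *: B|) < 1.
    by apply: le_lt_trans s1; rewrite normrZ; lra.
  have /(series_entry_cvg (i := i) (j := j)) := tanhc_defined hs.
  move=> /cvg_lim <- //; congr (limn _); congr series; apply/funext => k.
  by rewrite /c /= expmxZ !mxE -/(tanhc_coef R k); ring.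
have /nbhs_singleton dc := pseries_is_derive dB0 cM.
by apply: differentiable_continuous; apply/derivable1_diffP; case: dc.
Qed.

(** The scalar identity behind it: 1 - tanh z and (exp(2z) + 1) / 2 are inverse to
each other. *)
Lemma inverse_tanhc B : mxfun_defined (@tanhc R) B ->
  (1%:M + mxfun (@phi1 R) (2 *: B) *m B) *m
    (1%:M - mxfun (@tanhc R) B *m B) = 1%:M.
Proof.
move=> cT; rewrite mulmxBr mulmx1 mulmxA mxfun_tanhc_phi1//.
by rewrite addrK.
Qed.

(** The left-hand equation is the linearized scheme.  It reads X nu' = b with
X = 1 - T B, and E = 1 + P B is a two-sided inverse of X; the right-hand equation
is nu' = E b. *)
Lemma solve_linearized (h : R) (J : 'M[R]_d) (f nu nu' : 'cV[R]_d) :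
  let B := 2^-1 *: (h *: J) in
  mxfun_defined (@tanhc R) B ->
  - ((h *: mxfun (@tanhc R) B) *m f)
    + (nu' - nu - (h *: mxfun (@tanhc R) B) *m (2^-1 *: (J *m nu' + J *m nu))) = 0
  <-> nu' = mxfun (@expR R) (h *: J) *m nu
            + h *: (mxfun (@phi1 R) (h *: J) *m f).
Proof.
move=> B cT.
have AB : h *: J = 2 *: B by rewrite /B scalerA divff ?scale1r// pnatr_eq0.
have inv := inverse_tanhc cT; have inv' := mulmx1C inv.
have TP := mxfun_tanhc_phi1 cT.
rewrite AB mxfun_expR; move: inv inv' TP.
set P := mxfun (@phi1 R) _; set T := mxfun (@tanhc R) B.
set E := 1%:M + P *m B => inv inv' TP.
have -> : (h *: T) *m (2^-1 *: (J *m nu' + J *m nu)) = T *m B *m (nu' + nu).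
  rewrite -mulmxDr /B -!scalemxAl -!scalemxAr -!scalemxAl !scalerA mulmxA.
  by rewrite mulrC.
have -> : (1%:M + P *m (2 *: B)) *m nu + h *: (P *m f) =
    E *m ((1%:M + T *m B) *m nu + h *: (T *m f)).
  have -> : 1%:M + P *m (2 *: B) = E *m (1%:M + T *m B).
    by rewrite mulmxDr mulmx1 mulmxA TP -scalemxAr scaler_nat mulr2n addrA.
  rewrite [RHS]mulmxDr; congr (_ + _); first by rewrite mulmxA.
  by rewrite -scalemxAr mulmxA TP.
have -> : - (h *: T *m f) + (nu' - nu - T *m B *m (nu' + nu)) =
   (1%:M - T *m B) *m nu' - ((1%:M + T *m B) *m nu + h *: (T *m f)).
  rewrite mulmxBl mulmxDl !mul1mx mulmxDr -scalemxAl.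
  set a := h *: _; set b := T *m B *m nu'; set c := T *m B *m nu.
  by apply/colP => i; rewrite !mxE; lra.
split=> [/eqP|->].
  by rewrite subr_eq0 => /eqP <-; rewrite mulmxA inv mul1mx.
by rewrite mulmxA inv' mul1mx subrr.
Qed.

End MatrixFunctions.

(** * Differentiating the trapezoidal scheme *)

Section Calculus.
Context (R : realType) (d : nat).
Implicit Types (F : 'cV[R]_d -> 'cV[R]_d) (x v : 'cV[R]_d).

Lemma diff_jacobi F x v : differentiable F x -> 'd F x v = jacobi F x *m v.
Proof.
move=> dF; have {1}-> : v = \sum_j v j 0 *: delta_mx j 0.
  by rewrite {1}(matrix_sum_delta v); apply: eq_bigr => j _; rewrite big_ord1.
rewrite linear_sum /=; apply/colP => i; rewrite mxE summxE.
by apply: eq_bigr => j _; rewrite linearZ /= !mxE deriveE// mulrC.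
Qed.

Lemma jacobi_continuous F : smooth F -> continuous (jacobi F).
Proof.
move=> sF x; apply: (@mx_cvg _ _ (nbhs x)) => i j; rewrite mxE.
have [dF cF] := sF 1%N.
have -> : (fun y => jacobi F y i j) =
    (fun M : 'cV[R]_d => M i 0) \o (fun y => 'd F y (delta_mx j 0)).
  by apply/funext => y; rewrite mxE deriveE.
rewrite deriveE//.
exact: (continuous_comp (cF _ x) (@coord_continuous _ _ _ _ _ _)).
Qed.

(** Closed balls of row vectors are compact, and transposition carries this over
to columns. *)
Lemma bounded_on_ball (W : normedModType R) (G : 'cV[R]_d -> W) (M : R) :
  continuous G -> exists2 K, 0 <= K & forall x, `|x| <= M -> `|G x| <= K.
Proof.
move=> cG.
pose tr := fun v : 'rV[R]_d => (v^T : 'cV[R]_d).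
have ctr : continuous tr.
  move=> v; apply: (@mx_cvg _ _ (nbhs v)) => i j; rewrite mxE.
  by under eq_fun do rewrite mxE; exact: coord_continuous.
have normtr x : `|x^T : 'rV[R]_d| <= `|x|.
  by apply: mx_norm_le => // i j; rewrite mxE mx_entry_le.
have cpt : compact [set v : 'rV[R]_d | `|v| <= M].
  apply: bounded_closed_compact.
    exists M; split; first exact: num_real.
    by move=> y My v /= vM; apply: le_trans vM (ltW My).
  rewrite (_ : mkset _ = (fun v : 'rV[R]_d => `|v|) @^-1` [set r | r <= M])//.
  by apply: closed_comp; [move=> ? _; exact: norm_continuous | exact: closed_le].
have /compact_bounded[K [Kr HK]] :
    compact ((G \o tr) @` [set v : 'rV[R]_d | `|v| <= M]).
  apply: continuous_compact => //; apply: continuous_subspaceT => v.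
  exact: (continuous_comp (ctr v) (cG _)).
exists (`|K| + 1); first by rewrite addr_ge0.
move=> x xM; apply: (HK (`|K| + 1)).
  by rewrite (le_lt_trans (ler_norm K))// ltrDl.
exists x^T; first by rewrite /= (le_trans (normtr x)).
by rewrite /= /tr trmxK.
Qed.

Lemma is_diff_fst (U V : normedModType R) (p : U * V) : is_diff p fst fst.
Proof.
have cf : continuous (fst : U * V -> U) by move=> q; exact: cvg_fst.
by apply: DiffDef; [exact: linear_differentiable | exact: diff_lin].
Qed.

Lemma is_diff_snd (U V : normedModType R) (p : U * V) : is_diff p snd snd.
Proof.
have cf : continuous (snd : U * V -> V) by move=> q; exact: cvg_snd.
by apply: DiffDef; [exact: linear_differentiable | exact: diff_lin].
Qed.

Lemma is_diff_trapezoidal F delta h xbar : differentiable F xbar ->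
  is_diff (xbar, xbar) (residual (trapezoidal F delta) xbar h)
    (fun p => p.2 - p.1 - delta xbar h *m
        (2^-1 *: (jacobi F xbar *m p.2 + jacobi F xbar *m p.1))).
Proof.
move=> /differentiableP dF.
have d1 := is_diff_fst (xbar, xbar); have d2 := is_diff_snd (xbar, xbar).
have dF1 : is_diff (xbar, xbar) (F \o fst) ('d F xbar \o fst).
  exact: is_diff_comp.
have dF2 : is_diff (xbar, xbar) (F \o snd) ('d F xbar \o snd).
  exact: is_diff_comp.
have dM y : is_diff y (mulmx (delta xbar h) : 'cV[R]_d -> 'cV[R]_d)
    (mulmx (delta xbar h)).
  have cM := @mulmx_continuous R d d 1 (delta xbar h).
  by apply: DiffDef; [exact: linear_differentiable | exact: diff_lin].
have dS := is_diffB (is_diffB d2 d1)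
   (is_diff_comp (is_diffZ 2^-1 (is_diffD dF2 dF1)) (dM _)).
apply: (is_diff_eq dS); apply/funext => p /=.
have df : differentiable F xbar by [].
by rewrite -!diff_jacobi.
Qed.

End Calculus.

(** * The modified trapezoidal rule *)

Section TanhcScheme.
Context (R : realType) (d : nat) (F : 'cV[R]_d -> 'cV[R]_d) (sF : smooth F).
Let S := trapezoidal F (tanhc_step F).

Lemma tanhc_step_admissible : admissible_step (tanhc_step F).
Proof.
move=> xbar.
apply: cvg_trans (mxfun_tanhc_cvg1 (2^-1 *: jacobi F xbar)).
apply: near_eq_cvg; near=> h.
have h0 : h != 0 by near: h; exact: nbhs_dnbhs_neq.
by rewrite /tanhc_step [RHS]scalerA mulVf// scale1r /tanhc_arg !scalerA mulrC.
Unshelve. all: by end_near. Qed.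

Lemma tanhc_locally_exact_at h xbar :
  mxfun_defined (@tanhc R) (tanhc_arg F h xbar) -> locally_exact_at F S h xbar.
Proof.
move=> cT; have dF : differentiable F xbar by have [dF _] := sF 1%N.
have dS := @is_diff_trapezoidal _ _ F (tanhc_step F) h xbar dF.
split; first by case: dS.
move=> nu nu'; rewrite /linearized /exact_step (@diff_val _ _ _ _ _ _ _ dS) /=.
rewrite /residual /S /trapezoidal /= subrr sub0r.
have -> : 2^-1 *: (F xbar + F xbar) = F xbar.
  by rewrite -mulr2n -[F xbar *+ 2]scaler_nat scalerA mulVf ?scale1r// pnatr_eq0.
exact: solve_linearized.
Qed.

(** The bound 1/2, rather than just a bound below 1, keeps tanhc of the argument
uniformly bounded, as midpoint_close requires. *)
Lemma tanhc_arg_small K h xbar : 0 < h < (2 * d%:R * K + 1)^-1 ->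
  0 <= K -> `|jacobi F xbar| <= K ->
  2 * (d%:R * `|tanhc_arg F h xbar|) <= 2^-1.
Proof.
move=> /andP[h0 hK] K0 JK.
have dK0 : 0 <= d%:R * K by rewrite mulr_ge0.
have D0 : 0 < 2 * d%:R * K + 1 by rewrite -mulrA ltr_wpDl// mulr_ge0.
rewrite /tanhc_arg !normrZ gtr0_norm ?invr_gt0// (gtr0_norm h0).
have hJ : h * (d%:R * `|jacobi F xbar|) <= h * (d%:R * K).
  by rewrite ler_pM2l// ler_wpM2l.
move: hK; rewrite -div1r ltr_pdivlMr// => hK.
lra.
Qed.

Lemma tanhc_defined_near (C : R) (p : 'cV[R]_d) : exists2 e : R, 0 < e &
  forall h xbar, 0 < h < e -> `|xbar - p| <= C * h ->
    mxfun_defined (@tanhc R) (tanhc_arg F h xbar).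
Proof.
pose K := `|jacobi F p| + 1; have K0 : 0 <= K by rewrite addr_ge0.
have /cvgrPdist_lt/(_ _ ltr01) := @jacobi_continuous _ _ _ sF p.
move=> /nbhs_normP[del /= del0 Hdel].
have D0 : 0 < 2 * d%:R * K + 1 by rewrite ltr_wpDl// !mulr_ge0.
exists (Num.min (del / (`|C| + 1)) (2 * d%:R * K + 1)^-1).
  by rewrite lt_min invr_gt0 D0 divr_gt0// ltr_wpDl.
move=> h xbar /andP[h0]; rewrite lt_min => /andP[hdel hK] xp.
apply: tanhc_defined; apply: le_lt_trans (tanhc_arg_small (K := K) _ K0 _) _.
- by rewrite h0.
- have /= := Hdel xbar; rewrite /ball_ /= distrC => H.
  have {}H : `|jacobi F p - jacobi F xbar| < 1.
    apply: H; apply: le_lt_trans xp _; apply: (@le_lt_trans _ _ (h * (`|C| + 1))).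
      rewrite mulrC ler_pM2l//; apply: le_trans (ler_norm C) _.
      by rewrite lerDl.
    by rewrite -ltr_pdivlMr// ltr_wpDl.
  have -> : jacobi F xbar = jacobi F p - (jacobi F p - jacobi F xbar).
    by rewrite opprB addrC subrK.
  apply: le_trans (ler_normB _ _) _; rewrite /K lerD2l.
  exact: ltW.
- by rewrite invf_lt1// ltr1n.
Qed.

(** By the scheme, mid - x = (x' - x) / 2 is h / 2 times tanhc of a small argument
(of norm at most 2) times an average of values of F, which is bounded on the
ball. *)
Lemma midpoint_close M : exists2 h0 : R, 0 < h0 & exists C : R,
  forall h x x', 0 < h < h0 -> `|x| <= M -> `|x'| <= M ->
    let mid := 2^-1 *: (x + x') in
    mxfun_defined (@tanhc R) (tanhc_arg F h mid) /\
    (S mid h x x' = 0 -> `|mid - x| <= C * h).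
Proof.
have [K K0 HK] := bounded_on_ball M (jacobi_continuous sF).
have cF : continuous F := sF 0%N.
have [L L0 HL] := bounded_on_ball M cF.
exists (2 * d%:R * K + 1)^-1.
  by rewrite invr_gt0 ltr_wpDl// !mulr_ge0.
exists (d%:R * L) => h x x' hh xM x'M mid.
have midM : `|mid| <= M.
  rewrite normrZ gtr0_norm ?invr_gt0// mulrC ler_pdivrMr//.
  by rewrite (le_trans (ler_normD _ _))//; lra.
have small := tanhc_arg_small hh K0 (HK _ midM).
have small1 : 2 * (d%:R * `|tanhc_arg F h mid|) < 1.
  by apply: le_lt_trans small _; rewrite invf_lt1// ltr1n.
split; first exact: tanhc_defined.
rewrite /S /trapezoidal => /eqP; rewrite subr_eq0 => /eqP xx'.
have h0 : 0 < h by case/andP: hh.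
have -> : mid - x = 2^-1 *: (x' - x).
  by apply/colP => i; rewrite !mxE; lra.
rewrite xx' normrZ gtr0_norm ?invr_gt0//.
have T2 : `|mxfun (@tanhc R) (tanhc_arg F h mid)| <= 2.
  apply: mx_norm_le => // i j; apply: le_trans (mxfun_tanhc_le i j small1) _.
  rewrite -[leRHS]invrK lef_pV2 ?posrE ?invr_gt0//; last by rewrite subr_gt0.
  lra.
have FL : `|2^-1 *: (F x' + F x)| <= L.
  rewrite normrZ gtr0_norm ?invr_gt0// mulrC ler_pdivrMr//.
  have := HL _ xM; have := HL _ x'M; have := ler_normD (F x') (F x); lra.
have := mulmx_norm_le (tanhc_step F mid h) (2^-1 *: (F x' + F x)).
rewrite {2}/tanhc_step normrZ (gtr0_norm h0).
set a := `|_ *m _|; set t := `|mxfun _ _| in T2 *; set f := `|_ *: _| in FL *.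
move=> aH.
have : d%:R * (h * t) * f <= d%:R * (h * 2) * L.
  have t0 : 0 <= t by exact: normr_ge0.
  have ht0 : 0 <= h * t by rewrite mulr_ge0// ltW.
  apply: ler_pM FL; [by rewrite mulr_ge0 | exact: normr_ge0 |].
  by apply: ler_wpM2l => //; rewrite ler_pM2l.
lra.
Qed.

End TanhcScheme.

Theorem mainTheorem5 (R : realType) (d : nat) (F : 'cV[R]_d -> 'cV[R]_d)
    (hF : smooth F) :
  let S := trapezoidal F (tanhc_step F) in
  [/\ (* the scheme is a modification of the trapezoidal rule *)
      admissible_step (tanhc_step F),
      (* for sufficiently small steps the matrix function is defined and the
         scheme is locally exact, for any xbar_n with xbar_n - x_n = O(h_n);
         the threshold for h_n depends on x_n and on the O-constant only *)
      forall C : R, exists h0 : 'cV[R]_d -> R,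
        (forall p, 0 < h0 p) /\
        forall (h : nat -> R) (x xbar : nat -> 'cV[R]_d),
          (forall n, 0 < h n < h0 (x n)) ->
          (forall n, `|xbar n - x n| <= C * h n) ->
          (forall n, mxfun_defined (@tanhc R) (tanhc_arg F (h n) (xbar n))) /\
          locally_exact_with F S h x xbar,
      (* the only role of smallness is to make the matrix function defined *)
      forall (h : nat -> R) (x xbar : nat -> 'cV[R]_d),
        (forall n, 0 < h n) ->
        (exists C : R, forall n, `|xbar n - x n| <= C * h n) ->
        (forall n, mxfun_defined (@tanhc R) (tanhc_arg F (h n) (xbar n))) ->
        locally_exact_with F S h x xbar
    & (* the midpoint choice, along numerical solutions in a bounded region *)
      forall M : R, exists2 h0 : R, 0 < h0 &
        forall (h : nat -> R) (x : nat -> 'cV[R]_d),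
          let mid := fun n => 2^-1 *: (x n + x n.+1) in
          (forall n, 0 < h n < h0) -> (forall n, `|x n| <= M) ->
          solves S h x mid -> locally_exact_with F S h x mid].
Proof.
move=> S.
have locally_exact : forall (h : nat -> R) (x xbar : nat -> 'cV[R]_d),
    (exists C : R, forall n, `|xbar n - x n| <= C * h n) ->
    (forall n, mxfun_defined (@tanhc R) (tanhc_arg F (h n) (xbar n))) ->
    locally_exact_with F S h x xbar.
  by move=> h x xbar close def; split=> // n; exact: tanhc_locally_exact_at.
split.
- exact: tanhc_step_admissible.
- move=> C.
  have /choice[h0 Hh0] : forall p, exists e : R, 0 < e /\
      forall h xbar, 0 < h < e -> `|xbar - p| <= C * h ->
        mxfun_defined (@tanhc R) (tanhc_arg F h xbar).
    by move=> p; have [e e0 He] := tanhc_defined_near hF C p; exists e.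
  exists h0; split=> [p|h x xbar hh close]; first by case: (Hh0 p).
  have def n : mxfun_defined (@tanhc R) (tanhc_arg F (h n) (xbar n)).
    by have [_] := Hh0 (x n); apply.
  by split=> //; apply: locally_exact => //; exists C.
- by move=> h x xbar _; exact: locally_exact.
- move=> M; have [h0 h00 [C HC]] := midpoint_close hF M.
  exists h0; first exact: h00.
  move=> h x mid hh xM sol.
  have H n := HC (h n) (x n) (x n.+1) (hh n) (xM n) (xM n.+1).
  apply: locally_exact => [|n]; last by case: (H n).
  by exists C => n; have [_] := H n; apply; exact: sol.
Qed.
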